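(* Let $\theta$ be an irrational number whose best rational approximants $(p_n/q_n)_{n\ge0}$ satisfy $\lim_{n\to\infty}q_n^{-1}\log q_{n+1}=\infty$, and let $q'$ be a subsequence of $(q_n)_{n\ge0}$. Then there exists a dense $G_\delta$-subset $E_1$ of $l^\infty$ such that for every $u\in E_1$: $\mathbb{C}\times\Delta$ is a Fatou component of $A_{\theta,q',u}$, and for every $(w,z)\in\mathbb{C}^2$ with $|z|>1$ the forward orbit of $(w,z)$ under $A_{\theta,q',u}$ is unbounded. The same two conclusions hold for $A_{\theta,q'}$, i.e. for the constant sequence $u_m\equiv1$.
   Context: Best rational approximants $p_n/q_n$ of an irrational $\theta$ are its continued fraction convergents, with $\gcd(p_n,q_n)=1$, $q_n\ge0$. A subsequence $q'$ of $(q_n)$ means $q'_n=q_{k_n}$ with $k_n$ strictly increasing. $l^\infty$ is the complex Banach space of bounded complex sequences $u=(u_m)_{m\ge0}$ with the sup norm. $\Delta$ is the open unit disc. For $u\in l^\infty$, $\varphi_{\theta,q',u}(z)=z e^{2\pi i\theta}\sum_{n=0}^\infty u_{q'_n}(1-e^{2\pi i q'_n\theta})z^{q'_n}$ (an entire function under the growth hypothesis), and $A_{\theta,q',u}(w,z)=(e^{2\pi i\theta}w+\varphi_{\theta,q',u}(z),e^{2\pi i\theta}z)$, an automorphism of $\mathbb{C}^2$; $A_{\theta,q'}$ denotes $A_{\theta,q',u}$ with $u_m\equiv1$. For a holomorphic map $F:\mathbb{C}^2\to\mathbb{C}^2$, the Fatou set is the set of points having a neighbourhood on which the family of iterates $\{F^{\circ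 N}\}_{N\ge0}$ is equicontinuous (Euclidean metric); a Fatou component is a connected component of the Fatou set. *)

(* Defs.v *)
From Stdlib Require Import Reals Lra ZArith ClassicalEpsilon.
Open Scope R_scope.

Definition Cx : Type := (R * R)%type.
Definition Czero : Cx := (0, 0).
Definition Cone : Cx := (1, 0).
Definition Cadd (z w : Cx) : Cx := (fst z + fst w, snd z + snd w).
Definition Csub (z w : Cx) : Cx := (fst z - fst w, snd z - snd w).
Definition Cmul (z w : Cx) : Cx :=
  (fst z * fst w - snd z * snd w, fst z * snd w + snd z * fst w).
Fixpoint Cpow (z : Cx) (n : nat) : Cx :=
  match n with O => Cone | S m => Cmul z (Cpow z m) end.
Definition Cnorm (z : Cx) : R := sqrt (fst z ^ 2 + snd z ^ 2).
Definition Cexpi (t : R) : Cx := (cos t, sin t).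

Definition Cseries_cv (f : nat -> Cx) (s : Cx) : Prop :=
  Un_cv (fun N => sum_f_R0 (fun n => fst (f n)) N) (fst s) /\
  Un_cv (fun N => sum_f_R0 (fun n => snd (f n)) N) (snd s).

(* the sum of a convergent series (chosen classically; only used where the
   series converges) *)
Definition Cseries (f : nat -> Cx) : Cx :=
  epsilon (inhabits Czero) (fun s => Cseries_cv f s).

Definition irrational (x : R) : Prop :=
  forall p q : Z, q <> 0%Z -> x <> IZR p / IZR q.

Fixpoint cf_rem (theta : R) (n : nat) : R :=
  match n with
  | O => frac_part theta
  | S m => frac_part (/ cf_rem theta m)
  end.

Definition cf_a (theta : R) (n : nat) : nat :=
  match n with
  | O => Z.to_nat (Int_part theta)   (* a_0, not used for the q_n *)
  | S m => Z.to_nat (Int_part (/ cf_rem theta m))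
  end.

Fixpoint cf_q_aux (theta : R) (n : nat) : nat * nat :=
  match n with
  | O => (1%nat, cf_a theta 1)
  | S m => let '(a, b) := cf_q_aux theta m in
           (b, (cf_a theta (S (S m)) * b + a)%nat)
  end.

Definition cf_q (theta : R) (n : nat) : nat := fst (cf_q_aux theta n).

Definition bounded_seq (u : nat -> Cx) : Prop :=
  exists M : R, forall m, Cnorm (u m) <= M.

Definition linf_lt (u v : nat -> Cx) (r : R) : Prop :=
  exists r', r' < r /\ forall m, Cnorm (Csub (u m) (v m)) <= r'.

Definition linf_open (U : (nat -> Cx) -> Prop) : Prop :=
  forall u, bounded_seq u -> U u ->
    exists r, 0 < r /\
      forall v, bounded_seq v -> linf_lt u v r -> U v.

Definition linf_dense (E : (nat -> Cx) -> Prop) : Prop :=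
  forall u, bounded_seq u -> forall r, 0 < r ->
    exists v, E v /\ linf_lt u v r.

Definition linf_dense_Gdelta (E : (nat -> Cx) -> Prop) : Prop :=
  (forall u, E u -> bounded_seq u) /\
  (exists U : nat -> (nat -> Cx) -> Prop,
      (forall j, linf_open (U j)) /\
      (forall u, bounded_seq u -> (E u <-> forall j, U j u))) /\
  linf_dense E.

Definition C2 : Type := (Cx * Cx)%type.
Definition C2dist (p p' : C2) : R :=
  sqrt (Cnorm (Csub (fst p) (fst p')) ^ 2 + Cnorm (Csub (snd p) (snd p')) ^ 2).
Definition C2norm (p : C2) : R := C2dist p (Czero, Czero).

Definition C2open (U : C2 -> Prop) : Prop :=
  forall x, U x -> exists r, 0 < r /\ forall y, C2dist x y < r -> U y.

Definition C2connected (T : C2 -> Prop) : Prop :=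
  forall U1 U2 : C2 -> Prop, C2open U1 -> C2open U2 ->
    (forall x, T x -> U1 x \/ U2 x) ->
    (forall x, T x -> U1 x -> U2 x -> False) ->
    (forall x, T x -> U1 x) \/ (forall x, T x -> U2 x).

Definition iterate (F : C2 -> C2) (N : nat) (p : C2) : C2 := Nat.iter N F p.

Definition equicontinuous_on (F : C2 -> C2) (V : C2 -> Prop) : Prop :=
  forall x, V x -> forall eps, 0 < eps -> exists delta, 0 < delta /\
    forall y, V y -> C2dist x y < delta ->
      forall N, C2dist (iterate F N x) (iterate F N y) < eps.

Definition fatou_set (F : C2 -> C2) (p : C2) : Prop :=
  exists r, 0 < r /\ equicontinuous_on F (fun y => C2dist p y < r).

Definition fatou_component (F : C2 -> C2) (S : C2 -> Prop) : Prop :=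
  (exists x, S x) /\
  (forall x, S x -> fatou_set F x) /\
  C2connected S /\
  (forall T : C2 -> Prop, C2connected T -> (forall x, T x -> fatou_set F x) ->
     (exists x, T x /\ S x) -> forall x, T x -> S x).

Definition orbit_unbounded (F : C2 -> C2) (p : C2) : Prop :=
  ~ (exists M, forall N, C2norm (iterate F N p) <= M).

Definition C_times_disc (p : C2) : Prop := Cnorm (snd p) < 1.

Definition qsub (theta : R) (k : nat -> nat) (n : nat) : nat := cf_q theta (k n).

Definition phi (theta : R) (k : nat -> nat) (u : nat -> Cx) (z : Cx) : Cx :=
  Cmul (Cmul z (Cexpi (2 * PI * theta)))
    (Cseries (fun n =>
       Cmul (Cmul (u (qsub theta k n))
                  (Csub Cone (Cexpi (2 * PI * INR (qsub theta k n) * theta))))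
            (Cpow z (qsub theta k n)))).

Definition Amap (theta : R) (k : nat -> nat) (u : nat -> Cx) (p : C2) : C2 :=
  (Cadd (Cmul (Cexpi (2 * PI * theta)) (fst p)) (phi theta k u (snd p)),
   Cmul (Cexpi (2 * PI * theta)) (snd p)).

Definition two_conclusions (F : C2 -> C2) : Prop :=
  fatou_component F C_times_disc /\
  (forall w z : Cx, 1 < Cnorm z -> orbit_unbounded F (w, z)).

(* Main.v *)
From Stdlib Require Import Reals Lra Lia ZArith Classical ClassicalEpsilon.
From Coquelicot Require Import Coquelicot.
Require Import Defs.
Open Scope R_scope.

(** Write [l = exp(2 i pi theta)] and [q_n] for the subsequence [q'_n].  A geometric sum gives
    [A^N (w, z) = (l^N (w + z h_N(z)), l^N z)] with
    [h_N(z) = sum_n u_(q_n) (1 - l^(N q_n)) z^(q_n)].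
    For [|z| < 1] the [h_N] are locally uniformly bounded and Lipschitz, so the product of the
    plane with the open disc lies in the Fatou set.  For [|z| > 1], pick [m] with [u_(q_m)]
    bounded away from 0 and [N] such that [l^(N q_m)] has nonpositive real part; the growth
    hypothesis makes the [m]-th term of [h_N(z)] dominate all the others, and it is at least
    a constant times [|z|^(q_m)].  So all [u] that do not tend to 0 along [q'] work; they form
    an open dense set, which contains the constant sequence 1. *)

(** * Continued fractions *)


Lemma irrational_frac_part x : irrational x -> irrational (frac_part x).
Proof.
  intros Hx p q Hq E. apply (Hx (p + Int_part x * q)%Z q Hq).
  assert (IZR q <> 0) by (apply not_0_IZR; exact Hq).
  unfold frac_part in E. rewrite plus_IZR, mult_IZR.
  apply Rplus_eq_reg_r with (- IZR (Int_part x)).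
  transitivity (IZR p / IZR q); [lra | field; assumption].
Qed.

Lemma irrational_neq_0 x : irrational x -> x <> 0.
Proof. intros Hx E. apply (Hx 0%Z 1%Z); [lia | lra]. Qed.

Lemma irrational_inv x : irrational x -> irrational (/ x).
Proof.
  intros Hx p q Hq E.
  pose proof (irrational_neq_0 x Hx) as Hx0.
  assert (IZR q <> 0) by (apply not_0_IZR; exact Hq).
  assert (Hp : p <> 0%Z).
  { intros ->. apply (Rinv_neq_0_compat x Hx0). rewrite E. field; assumption. }
  apply (Hx q p Hp).
  assert (IZR p <> 0) by (apply not_0_IZR; exact Hp).
  rewrite <- (Rinv_inv x), E. field; auto.
Qed.

Lemma frac_part_irrational_bounds x : irrational x -> 0 < frac_part x < 1.
Proof.
  intros Hx. destruct (base_fp x).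
  pose proof (irrational_neq_0 _ (irrational_frac_part x Hx)). lra.
Qed.

Lemma cf_rem_irrational theta n : irrational theta -> irrational (cf_rem theta n).
Proof.
  intros H. induction n as [|n IH]; apply irrational_frac_part; [exact H|].
  apply irrational_inv, IH.
Qed.

Lemma cf_rem_bounds theta n : irrational theta -> 0 < cf_rem theta n < 1.
Proof.
  intros H. destruct n; apply frac_part_irrational_bounds; [exact H|].
  apply irrational_inv, cf_rem_irrational, H.
Qed.

Lemma Int_part_ge_1 x : 1 <= x -> (1 <= Int_part x)%Z.
Proof.
  intros Hx. destruct (base_Int_part x) as [_ H].
  apply Zlt_succ_le, lt_IZR. unfold Z.succ. rewrite plus_IZR. lra.
Qed.

Lemma inv_cf_rem_ge_1 theta n : irrational theta -> 1 <= / cf_rem theta n.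
Proof.
  intros H. pose proof (cf_rem_bounds theta n H).
  rewrite <- Rinv_1. apply Rinv_le_contravar; lra.
Qed.

Lemma INR_cf_a theta n : irrational theta ->
  INR (cf_a theta (S n)) = / cf_rem theta n - cf_rem theta (S n).
Proof.
  intros H. pose proof (Int_part_ge_1 _ (inv_cf_rem_ge_1 theta n H)).
  simpl cf_a. rewrite INR_IZR_INZ, Z2Nat.id by lia.
  simpl cf_rem. unfold frac_part. lra.
Qed.

Lemma cf_a_ge_1 theta n : irrational theta -> (1 <= cf_a theta (S n))%nat.
Proof.
  intros H. pose proof (Int_part_ge_1 _ (inv_cf_rem_ge_1 theta n H)).
  simpl cf_a. lia.
Qed.

Lemma snd_cf_q_aux theta n : snd (cf_q_aux theta n) = cf_q theta (S n).
Proof. unfold cf_q. simpl. destruct (cf_q_aux theta n). reflexivity. Qed.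

Lemma cf_q_SS theta n :
  cf_q theta (S (S n)) = (cf_a theta (S (S n)) * cf_q theta (S n) + cf_q theta n)%nat.
Proof.
  rewrite <- snd_cf_q_aux, <- (snd_cf_q_aux theta n). unfold cf_q.
  simpl. destruct (cf_q_aux theta n). reflexivity.
Qed.

(** The recurrence involves two consecutive denominators, so all the bounds are carried through one
    induction; partial quotients are at least 1. The bound n <= q_n later turns sums over q_n into
    geometric sums. *)
Lemma cf_q_ge theta n : irrational theta ->
  (1 <= cf_q theta n <= cf_q theta (S n) /\ n <= cf_q theta n /\
   S n <= cf_q theta (S n))%nat.
Proof.
  intros H. induction n as [|n IH].
  - pose proof (cf_a_ge_1 theta 0 H). unfold cf_q. simpl in *. lia.
  - pose proof (cf_q_SS theta n). pose proof (cf_a_ge_1 theta (S n) H). nia.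
Qed.

Lemma cf_q_mono theta m n : irrational theta -> (m <= n)%nat ->
  (cf_q theta m <= cf_q theta n)%nat.
Proof.
  intros H. induction 1 as [|n _ IH]; [lia|].
  pose proof (cf_q_ge theta n H). lia.
Qed.

(* [cf_err theta n] is [|q_n theta - p_n|], where [p_n / q_n] is the [n]-th convergent. *)
Fixpoint cf_err (theta : R) (n : nat) : R :=
  match n with
  | O => cf_rem theta 0
  | S m => cf_err theta m * cf_rem theta (S m)
  end.

Lemma cf_err_pos theta n : irrational theta -> 0 < cf_err theta n.
Proof.
  intros H. induction n as [|n IH]; [apply cf_rem_bounds, H|].
  cbn [cf_err]. apply Rmult_lt_0_compat; [exact IH | apply cf_rem_bounds, H].
Qed.

(** Substitute a = 1/r - r' for consecutive remainders r, r': the errors obey the recurrence of the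
    q_n with the sign of the middle term reversed. *)
Lemma cf_err_SS theta n : irrational theta ->
  cf_err theta (S (S n)) = cf_err theta n - INR (cf_a theta (S (S n))) * cf_err theta (S n).
Proof.
  intros H. rewrite INR_cf_a by exact H. cbn [cf_err].
  pose proof (cf_rem_bounds theta (S n) H). field. lra.
Qed.

(** This is the determinant identity for consecutive convergents with the numerators eliminated. The
    partial quotients cancel in the induction because the two recurrences carry opposite signs. *)
Lemma cf_err_cross theta n : irrational theta ->
  cf_err theta n * INR (cf_q theta (S n)) + cf_err theta (S n) * INR (cf_q theta n) = 1.
Proof.
  intros H. induction n as [|n IH].
  - replace (cf_q theta 1) with (cf_a theta 1) by reflexivity.
    rewrite INR_cf_a by exact H. unfold cf_q. cbn [cf_err cf_q_aux fst INR].
    pose proof (cf_rem_bounds theta 0 H). field. lra.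
  - rewrite cf_err_SS, cf_q_SS, plus_INR, mult_INR by exact H. lra.
Qed.

(** Both terms of [cf_err_cross] are positive, which gives the upper bound. The errors decrease and
    the q_n increase, so the first term is the larger one and is at least 1/2. *)
Lemma cf_err_bounds theta n : irrational theta ->
  / (2 * INR (cf_q theta (S n))) <= cf_err theta n <= / INR (cf_q theta (S n)).
Proof.
  intros H.
  pose proof (cf_err_cross theta n H) as E.
  destruct (cf_q_ge theta n H) as [[Hq1 Hq2] _].
  apply le_INR in Hq1, Hq2. simpl in Hq1.
  pose proof (cf_err_pos theta n H). pose proof (cf_err_pos theta (S n) H).
  assert (cf_err theta (S n) <= cf_err theta n).
  { cbn [cf_err]. pose proof (cf_rem_bounds theta (S n) H). nra. }
  split; apply Rmult_le_reg_r with (2 * INR (cf_q theta (S n))); try lra.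
  - rewrite Rinv_l by lra. nra.
  - replace (/ INR (cf_q theta (S n)) * (2 * INR (cf_q theta (S n)))) with 2
      by (field; lra). nra.
Qed.

(** The integer is the numerator p_n. Two consecutive indices are proved together because the
    recurrence has order two. *)
Lemma cf_q_theta theta n : irrational theta ->
  exists p : Z, INR (cf_q theta n) * theta = IZR p + (-1) ^ n * cf_err theta n.
Proof.
  intros H.
  enough ((exists p : Z, INR (cf_q theta n) * theta = IZR p + (-1) ^ n * cf_err theta n) /\
    (exists p : Z, INR (cf_q theta (S n)) * theta = IZR p + (-1) ^ S n * cf_err theta (S n)))
    by tauto.
  induction n as [|n [[p Hp] [p' Hp']]].
  - split.
    + exists (Int_part theta). unfold cf_q. cbn. unfold frac_part. lra.
    + exists (Z.of_nat (cf_a theta 1) * Int_part theta + 1)%Z.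
      replace (cf_q theta 1) with (cf_a theta 1) by reflexivity.
      rewrite plus_IZR, mult_IZR, <- INR_IZR_INZ, INR_cf_a by exact H.
      pose proof (cf_rem_bounds theta 0 H) as B.
      cbn [cf_err pow].
      replace (IZR (Int_part theta)) with (theta - cf_rem theta 0)
        by (cbn; unfold frac_part; lra).
      field. lra.
  - split; [exists p'; exact Hp'|].
    exists (Z.of_nat (cf_a theta (S (S n))) * p' + p)%Z.
    rewrite cf_q_SS, plus_INR, mult_INR, plus_IZR, mult_IZR, <- INR_IZR_INZ.
    rewrite Rmult_plus_distr_r, Rmult_assoc, Hp', Hp, cf_err_SS by exact H.
    cbn [pow]. ring.
Qed.

Lemma cos_period_Z x (k : Z) : cos (x + 2 * PI * IZR k) = cos x.
Proof.
  destruct (Z_le_dec 0 k).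
  - rewrite <- (cos_period x (Z.to_nat k)), INR_IZR_INZ, Z2Nat.id by lia.
    f_equal; ring.
  - rewrite <- (cos_period _ (Z.to_nat (- k))), INR_IZR_INZ, Z2Nat.id, opp_IZR by lia.
    f_equal; ring.
Qed.

(** The integer p_n drops out by periodicity and the sign (-1)^n by evenness of the cosine. *)
Lemma cos_cf_q theta n N : irrational theta ->
  cos (INR N * (2 * PI * INR (cf_q theta n) * theta)) =
  cos (2 * PI * INR N * cf_err theta n).
Proof.
  intros H. destruct (cf_q_theta theta n H) as [p Hp].
  transitivity (cos ((-1) ^ n * (2 * PI * INR N * cf_err theta n) +
                     2 * PI * IZR (Z.of_nat N * p))).
  - f_equal. rewrite mult_IZR, <- INR_IZR_INZ.
    transitivity (2 * PI * INR N * (INR (cf_q theta n) * theta)); [ring|].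
    rewrite Hp. ring.
  - rewrite cos_period_Z.
    destruct (Nat.Even_or_Odd n) as [[j ->]|[j ->]].
    + rewrite pow_1_even. f_equal; ring.
    + replace (2 * j + 1)%nat with (S (2 * j)) by lia.
      rewrite pow_1_odd, <- cos_neg. f_equal; ring.
Qed.

(** * Chords of the circle and complex series *)


Lemma Cexpi_plus x y : Cexpi (x + y) = (Cexpi x * Cexpi y)%C.
Proof. unfold Cexpi, Cmult. simpl. rewrite cos_plus, sin_plus. f_equal; ring. Qed.

Lemma Cexpi_pow x n : Complex.Cpow (Cexpi x) n = Cexpi (INR n * x).
Proof.
  induction n as [|n IH].
  - simpl. rewrite Rmult_0_l. unfold Cexpi. rewrite cos_0, sin_0. reflexivity.
  - rewrite Cpow_S, IH, <- Cexpi_plus, S_INR. f_equal. ring.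
Qed.

Lemma Cmod_Cexpi x : Cmod (Cexpi x) = 1.
Proof.
  unfold Cmod, Cexpi. simpl fst; simpl snd.
  pose proof (sin2_cos2 x) as E. unfold Rsqr in E.
  replace (cos x ^ 2 + sin x ^ 2) with 1 by lra. apply sqrt_1.
Qed.

Lemma Cmod_1_minus_Cexpi x : Cmod (1 - Cexpi x) = sqrt (2 - 2 * cos x).
Proof.
  unfold Cmod, Cexpi. simpl fst; simpl snd. f_equal.
  pose proof (sin2_cos2 x) as E. unfold Rsqr in E. lra.
Qed.

Lemma chord_le_2 x : sqrt (2 - 2 * cos x) <= 2.
Proof.
  pose proof (COS_bound x). apply Rle_trans with (sqrt (2 ^ 2)); [apply sqrt_le_1; lra|].
  rewrite sqrt_pow2; lra.
Qed.

(** By the half-angle formula 2 - 2 cos x = 4 sin^2(x/2), it suffices that |sin(x/2)| <= x/2. *)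
Lemma chord_le_arc x : 0 <= x -> sqrt (2 - 2 * cos x) <= x.
Proof.
  intros Hx. pose proof (COS_bound x).
  apply Rle_trans with (sqrt (x ^ 2)); [|rewrite sqrt_pow2; lra].
  apply sqrt_le_1; [lra | nra |].
  replace x with (2 * (x / 2)) at 1 by field. rewrite cos_2a_sin.
  assert (0 <= x / 2) by lra.
  assert (sin (x / 2) <= x / 2).
  { destruct (Req_dec (x / 2) 0) as [->|]; [rewrite sin_0; lra|].
    left. apply sin_lt_x. lra. }
  assert (- (x / 2) <= sin (x / 2)).
  (* Up to 1 < pi/2 the sine is nonnegative; beyond 1 the trivial bound -1 is enough. *)
  { destruct (Rle_dec (x / 2) 1).
    - assert (0 <= sin (x / 2)); [|lra].
      apply sin_ge_0; [lra|]. pose proof PI2_1. lra.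
    - pose proof (SIN_bound (x / 2)). lra. }
  nra.
Qed.

(** Built by coordinates so that its components are literally the real partial sums in
    [Cseries_cv]. *)
Definition Csum (f : nat -> C) (N : nat) : C :=
  (sum_f_R0 (fun n => fst (f n)) N, sum_f_R0 (fun n => snd (f n)) N).

Lemma Csum_0 f : Csum f 0 = f 0%nat.
Proof. unfold Csum. simpl. destruct (f 0%nat). reflexivity. Qed.

Lemma Csum_S f N : Csum f (S N) = (Csum f N + f (S N))%C.
Proof. reflexivity. Qed.

Lemma Cmod_Csum_le f b N : (forall n, Cmod (f n) <= b n) ->
  Cmod (Csum f N) <= sum_f_R0 b N.
Proof.
  intros H. induction N as [|N IH]; [rewrite Csum_0; apply H|].
  rewrite Csum_S. simpl sum_f_R0.
  pose proof (Cmod_triangle (Csum f N) (f (S N))). pose proof (H (S N)). lra.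
Qed.

(** Replacing the m-th term by 0 reduces this to [Cmod_Csum_le]; it serves to isolate a dominant
    term. *)
Lemma Cmod_Csum_minus_term_le f b m N : (m <= N)%nat ->
  (forall n, 0 <= b n) -> (forall n, n <> m -> Cmod (f n) <= b n) ->
  Cmod (Csum f N - f m) <= sum_f_R0 b N.
Proof.
  intros Hm Hb H.
  set (g := fun n => if Nat.eq_dec n m then RtoC 0 else f n).
  assert (Hg : forall n, Cmod (g n) <= b n).
  { intros n. unfold g. destruct (Nat.eq_dec n m); [rewrite Cmod_0|]; auto. }
  replace (Csum f N - f m)%C with (Csum g N); [apply Cmod_Csum_le, Hg|].
  assert (E : forall j, Csum g j = (Csum f j - if le_dec m j then f m else 0)%C).
  { clear Hm Hb H Hg. induction j as [|j IH].
    - rewrite !Csum_0. unfold g.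
      destruct (Nat.eq_dec 0 m) as [E|], (le_dec m 0); try lia; [rewrite <- E|]; ring.
    - rewrite !Csum_S, IH. unfold g.
      destruct (Nat.eq_dec (S j) m) as [E|], (le_dec m j), (le_dec m (S j));
        try lia; [rewrite <- E| |]; ring. }
  rewrite E. destruct (le_dec m N); [reflexivity | contradiction].
Qed.

Lemma Cseries_cv_Cmod_le f s a B m : Cseries_cv f s ->
  (forall N, (m <= N)%nat -> Cmod (Csum f N - a) <= B) -> Cmod (s - a) <= B.
Proof.
  intros [H1 H2] H. apply Rnot_lt_le. intros Hlt.
  (* Each coordinate may be off by e, hence the partial sum by less than 2e, which is below the
     excess 3e. *)
  set (e := (Cmod (s - a) - B) / 3). assert (0 < e) by (unfold e; lra).
  destruct (H1 e) as [N1 HN1]; [lra|]. destruct (H2 e) as [N2 HN2]; [lra|].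
  set (N := (m + N1 + N2)%nat).
  specialize (H N ltac:(lia)). specialize (HN1 N ltac:(lia)). specialize (HN2 N ltac:(lia)).
  assert (D : Cmod (s - Csum f N) < 2 * e).
  { replace (s - Csum f N)%C with ((fst s - fst (Csum f N))%R + Ci * (snd s - snd (Csum f N))%R)%C
      by (unfold Cminus, Cplus, Cmult, Ci, RtoC; destruct s; simpl; f_equal; ring).
    eapply Rle_lt_trans; [apply Cmod_triangle|].
    rewrite Cmod_mult, Cmod_Ci, !Cmod_R.
    unfold Rdist in *. rewrite (Rabs_minus_sym (fst s)), (Rabs_minus_sym (snd s)).
    simpl fst; simpl snd. lra. }
  pose proof (Cmod_triangle (s - Csum f N) (Csum f N - a)) as T.
  replace (s - Csum f N + (Csum f N - a))%C with (s - a)%C in T by ring.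
  unfold e in D. lra.
Qed.

Lemma Cseries_cv_bound f s B : Cseries_cv f s ->
  (forall N, Cmod (Csum f N) <= B) -> Cmod s <= B.
Proof.
  intros H HB. replace s with (s - 0)%C by ring.
  apply (Cseries_cv_Cmod_le f s (RtoC 0) B 0 H). intros N _.
  replace (Csum f N - 0)%C with (Csum f N) by ring. apply HB.
Qed.

Lemma Cseries_cv_plus (f g : nat -> C) s t : Cseries_cv f s -> Cseries_cv g t ->
  Cseries_cv (fun n => (f n + g n)%C) (s + t)%C.
Proof.
  intros [F1 F2] [G1 G2]. split; simpl.
  - eapply Un_cv_ext; [|apply CV_plus; [exact F1 | exact G1]].
    intros N. symmetry; apply plus_sum.
  - eapply Un_cv_ext; [|apply CV_plus; [exact F2 | exact G2]].
    intros N. symmetry; apply plus_sum.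
Qed.

Lemma Cseries_cv_minus (f g : nat -> C) s t : Cseries_cv f s -> Cseries_cv g t ->
  Cseries_cv (fun n => (f n - g n)%C) (s - t)%C.
Proof.
  intros [F1 F2] [G1 G2]. split; simpl.
  - eapply Un_cv_ext; [|apply CV_minus; [exact F1 | exact G1]].
    intros N. symmetry; apply minus_sum.
  - eapply Un_cv_ext; [|apply CV_minus; [exact F2 | exact G2]].
    intros N. symmetry; apply minus_sum.
Qed.

Lemma Cseries_cv_ext (f g : nat -> C) s : (forall n, f n = g n) -> Cseries_cv f s -> Cseries_cv g s.
Proof.
  intros E [F1 F2]. split.
  - eapply Un_cv_ext; [|exact F1]. intros N. apply sum_eq. intros; rewrite E; reflexivity.
  - eapply Un_cv_ext; [|exact F2]. intros N. apply sum_eq. intros; rewrite E; reflexivity.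
Qed.

Lemma Cseries_cv_0 : Cseries_cv (fun _ => RtoC 0) (RtoC 0).
Proof.
  split; simpl; apply (Un_cv_ext (fun _ => 0));
    try (intros N; symmetry; apply sum_eq_R0; reflexivity);
    intros e He; exists 0%nat; intros; rewrite Rdist_eq; exact He.
Qed.

(** Comparison with a geometric tail makes both coordinate series converge, so the classical choice
    in [Cseries] returns a genuine sum. *)
Lemma Cseries_cv_geom f (A x : R) n0 : 0 <= x < 1 ->
  (forall n, (n0 <= n)%nat -> Cmod (f n) <= A * x ^ n) ->
  Cseries_cv f (Cseries f).
Proof.
  intros Hx H. unfold Cseries. apply epsilon_spec.
  assert (B : ex_series (fun j => A * x ^ (n0 + j))).
  { apply ex_series_incr_n with (a := fun j => A * x ^ j).
    apply (ex_series_scal (K := R_AbsRing) (V := R_NormedModule) A (fun n => x ^ n)).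
    apply ex_series_geom.
    rewrite Rabs_right; lra. }
  assert (P : forall p : C -> R, (forall c, Rabs (p c) <= Cmod c) ->
            exists l, Un_cv (fun N => sum_f_R0 (fun n => p (f n)) N) l).
  { intros p Hp.
    destruct (proj2 (ex_series_incr_n (fun n => p (f n)) n0)) as [l Hl].
    - eapply (ex_series_le (K := R_AbsRing) (V := R_CompleteNormedModule)); [|exact B].
      intros j. eapply Rle_trans; [apply Hp | apply H; lia].
    - exists l. apply is_series_Reals in Hl. exact Hl. }
  destruct (P fst) as [a Ha].
  { intros c. eapply Rle_trans; [|apply Rmax_Cmod]. apply Rmax_l. }
  destruct (P snd) as [b Hb].
  { intros c. eapply Rle_trans; [|apply Rmax_Cmod]. apply Rmax_r. }
  exists (a, b). split; assumption.
Qed.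

Lemma sum_geom_le x N : 0 <= x < 1 -> sum_f_R0 (fun n => x ^ n) N <= / (1 - x).
Proof.
  intros Hx. rewrite tech3 by lra.
  apply Rmult_le_reg_r with (1 - x); [lra|].
  unfold Rdiv. rewrite Rmult_assoc, Rinv_l, Rmult_1_r by lra.
  pose proof (pow_le x (S N)). lra.
Qed.

Lemma pow_le_pow_of_le_1 x m n : 0 <= x <= 1 -> (m <= n)%nat -> x ^ n <= x ^ m.
Proof.
  intros Hx Hmn. replace n with (m + (n - m))%nat by lia. rewrite pow_add.
  pose proof (pow_le x m ltac:(lra)).
  pose proof (pow_incr x 1 (n - m) Hx) as P. rewrite pow1 in P. nra.
Qed.

(** The n copies of x^n are compared one by one with larger terms of the geometric sum. This absorbs
    the factor q in the Lipschitz constant of z^q. *)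
Lemma INR_mul_pow_le x n : 0 <= x < 1 -> INR n * x ^ n <= / (1 - x).
Proof.
  intros Hx. eapply Rle_trans; [|apply (sum_geom_le x n Hx)].
  destruct n as [|n]; [simpl; lra|].
  assert (E : forall j, (j <= S n)%nat -> INR j * x ^ S n <= sum_f_R0 (fun i => x ^ i) j).
  { induction j as [|j IH]; intros Hj; [simpl; lra|].
    rewrite S_INR. simpl sum_f_R0.
    pose proof (pow_le_pow_of_le_1 x (S j) (S n) ltac:(lra) Hj).
    specialize (IH ltac:(lia)). simpl in *. lra. }
  apply E. lia.
Qed.

(** The usual Lipschitz bound n r^(n-1), multiplied by r to avoid the exponent n - 1. The induction
    splits z^(n+1) - y^(n+1) as z (z^n - y^n) + (z - y) y^n. *)
Lemma Cmod_pow_minus_le (z y : C) r n : Cmod z <= r -> Cmod y <= r ->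
  r * Cmod (Complex.Cpow z n - Complex.Cpow y n) <= INR n * r ^ n * Cmod (z - y).
Proof.
  intros Hz Hy. pose proof (Cmod_ge_0 z).
  induction n as [|n IH].
  - simpl Complex.Cpow. replace (1 - 1)%C with (RtoC 0) by ring. rewrite Cmod_0. simpl. lra.
  - rewrite !Cpow_S, S_INR.
    replace (z * Complex.Cpow z n - y * Complex.Cpow y n)%C
      with (z * (Complex.Cpow z n - Complex.Cpow y n) + (z - y) * Complex.Cpow y n)%C by ring.
    pose proof (Cmod_triangle (z * (Complex.Cpow z n - Complex.Cpow y n))
                              ((z - y) * Complex.Cpow y n)) as T.
    rewrite !Cmod_mult, Cmod_pow in T.
    set (d := Cmod (Complex.Cpow z n - Complex.Cpow y n)) in *.
    assert (0 <= d) by apply Cmod_ge_0.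
    pose proof (Cmod_ge_0 (z - y)) as Hd. set (e := Cmod (z - y)) in *.
    pose proof (pow_incr (Cmod y) r n (conj (Cmod_ge_0 y) Hy)).
    pose proof (pow_le (Cmod y) n (Cmod_ge_0 y)).
    assert (Cmod z * d <= r * d) by nra.
    assert (r * (Cmod z * d) <= r * (INR n * r ^ n * e)) by nra.
    assert (e * Cmod y ^ n <= e * r ^ n) by nra.
    assert (r * (e * Cmod y ^ n) <= r * (e * r ^ n)) by nra.
    simpl pow. nra.
Qed.

(** * Iterates and their power series *)


Definition super_exponential (theta : R) : Prop :=
  cv_infty (fun n => ln (INR (cf_q theta (S n))) / INR (cf_q theta n)).

Lemma subsequence_ge (k : nat -> nat) : (forall n, (k n < k (S n))%nat) ->
  forall n, (n <= k n)%nat.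
Proof. intros Hk. induction n as [|n IH]; [lia|]. specialize (Hk n). lia. Qed.

Lemma subsequence_lt (k : nat -> nat) : (forall n, (k n < k (S n))%nat) ->
  forall m n, (m < n)%nat -> (k m < k n)%nat.
Proof. intros Hk m n. induction 1 as [|n _ IH]; [apply Hk|]. specialize (Hk n). lia. Qed.

Lemma qsub_ge theta k n : irrational theta -> (forall n, (k n < k (S n))%nat) ->
  (n <= qsub theta k n)%nat.
Proof.
  intros H Hk. pose proof (subsequence_ge k Hk n).
  destruct (cf_q_ge theta (k n) H) as (_ & ? & _). unfold qsub. lia.
Qed.

Lemma cf_q_succ_le_qsub theta k m n : irrational theta ->
  (forall n, (k n < k (S n))%nat) -> (m < n)%nat ->
  (cf_q theta (S (k m)) <= qsub theta k n)%nat.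
Proof.
  intros H Hk Hmn. apply cf_q_mono; [exact H|].
  pose proof (subsequence_lt k Hk m n Hmn). lia.
Qed.

Lemma qsub_mono theta k m n : irrational theta ->
  (forall n, (k n < k (S n))%nat) -> (m <= n)%nat ->
  (qsub theta k m <= qsub theta k n)%nat.
Proof.
  intros H Hk Hmn. apply cf_q_mono; [exact H|].
  destruct (Nat.eq_dec m n) as [->|]; [lia|].
  pose proof (subsequence_lt k Hk m n ltac:(lia)). lia.
Qed.

Lemma INR_cf_q_ge_1 theta n : irrational theta -> 1 <= INR (cf_q theta n).
Proof. intros H. apply (le_INR 1), cf_q_ge, H. Qed.

(** The growth hypothesis in exponentiated form; K is chosen later to beat the radius and leave some
    spare decay. The threshold passes to the subsequence because n <= k n. *)
Lemma exp_qsub_le theta k K : irrational theta -> super_exponential theta ->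
  (forall n, (k n < k (S n))%nat) ->
  exists n0, forall n, (n0 <= n)%nat ->
    exp (K * INR (qsub theta k n)) <= INR (cf_q theta (S (k n))).
Proof.
  intros H Hg Hk. destruct (Hg K) as [n0 Hn0]. exists n0. intros n Hn.
  pose proof (subsequence_ge k Hk n). specialize (Hn0 (k n) ltac:(lia)).
  pose proof (INR_cf_q_ge_1 theta (k n) H). pose proof (INR_cf_q_ge_1 theta (S (k n)) H).
  rewrite <- (exp_ln (INR (cf_q theta (S (k n))))) by lra.
  left. apply exp_increasing. unfold qsub.
  apply Rmult_lt_reg_r with (/ INR (cf_q theta (k n))); [apply Rinv_0_lt_compat; lra|].
  rewrite Rmult_assoc, Rinv_r by lra. unfold Rdiv in Hn0. lra.
Qed.

(** The n-th term of the series h_N(z); N = 1 gives the series inside [phi]. *)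
Definition orbit_term (theta : R) (k : nat -> nat) (u : nat -> Cx) (N : nat)
    (z : C) (n : nat) : C :=
  (u (qsub theta k n)
   * (1 - Cexpi (INR N * (2 * PI * INR (qsub theta k n) * theta)))
   * Complex.Cpow z (qsub theta k n))%C.

Lemma Cmod_orbit_term theta k u N z n : irrational theta ->
  Cmod (orbit_term theta k u N z n) =
  Cmod (u (qsub theta k n))
  * sqrt (2 - 2 * cos (2 * PI * INR N * cf_err theta (k n)))
  * Cmod z ^ qsub theta k n.
Proof.
  intros H. unfold orbit_term, qsub.
  rewrite !Cmod_mult, Cmod_pow, Cmod_1_minus_Cexpi, cos_cf_q by exact H. reflexivity.
Qed.

(** Uniform in N: used inside the disc, and outside it for the terms before the dominant one. *)
Lemma Cmod_orbit_term_le_2 theta k u M N z n : irrational theta ->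
  (forall m, Cmod (u m) <= M) ->
  Cmod (orbit_term theta k u N z n) <= 2 * M * Cmod z ^ qsub theta k n.
Proof.
  intros H HM. rewrite Cmod_orbit_term by exact H.
  apply Rmult_le_compat_r; [apply pow_le, Cmod_ge_0|].
  rewrite (Rmult_comm 2 M). apply Rmult_le_compat;
    [apply Cmod_ge_0 | apply sqrt_pos | apply HM | apply chord_le_2].
Qed.

(** The chord is at most the arc, and [cf_err_bounds] gives the gain 1/q_(k n + 1), decisive when
    that denominator is large compared with N |z|^q. *)
Lemma Cmod_orbit_term_le theta k u M N z n : irrational theta ->
  (forall m, Cmod (u m) <= M) ->
  Cmod (orbit_term theta k u N z n) <=
  M * (2 * PI * INR N / INR (cf_q theta (S (k n)))) * Cmod z ^ qsub theta k n.
Proof.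
  intros H HM. rewrite Cmod_orbit_term by exact H.
  pose proof PI_RGT_0. pose proof (pos_INR N).
  pose proof (cf_err_pos theta (k n) H).
  assert (0 <= 2 * PI * INR N) by nra.
  apply Rmult_le_compat_r; [apply pow_le, Cmod_ge_0|].
  apply Rmult_le_compat; [apply Cmod_ge_0 | apply sqrt_pos | apply HM|].
  eapply Rle_trans; [apply chord_le_arc; nra|].
  apply Rmult_le_compat_l; [assumption | apply cf_err_bounds, H].
Qed.

Lemma pow_eq_exp x n : 0 < x -> x ^ n = exp (ln x * INR n).
Proof.
  intros Hx. rewrite <- Rpower_pow, Rmult_comm by exact Hx. reflexivity.
Qed.

Lemma exp_neg_pow n q : (n <= q)%nat -> exp (- INR q) <= exp (-1) ^ n.
Proof.
  intros H. rewrite pow_eq_exp, ln_exp by apply exp_pos. apply le_INR in H.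
  destruct (Req_dec (INR q) (INR n)) as [->|]; [right; f_equal; ring|].
  left. apply exp_increasing. lra.
Qed.

Lemma exp_m1_bounds : 0 <= exp (-1) < 1.
Proof.
  split; [left; apply exp_pos|]. rewrite <- exp_0. apply exp_increasing. lra.
Qed.

Lemma orbit_term_decay theta k u M N z R0 : irrational theta -> super_exponential theta ->
  (forall n, (k n < k (S n))%nat) -> (forall m, Cmod (u m) <= M) ->
  0 < R0 -> Cmod z <= R0 ->
  exists n0, forall n, (n0 <= n)%nat ->
    Cmod (orbit_term theta k u N z n) <= M * (2 * PI * INR N) * exp (-1) ^ n.
Proof.
  intros H Hg Hk HM HR Hz.
  (* The summand ln R0 pays for R0^q, and the summand 1 leaves exp(-q) <= exp(-n). *)
  destruct (exp_qsub_le theta k (ln R0 + 1) H Hg Hk) as [n0 Hn0].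
  exists n0. intros n Hn. specialize (Hn0 n Hn).
  eapply Rle_trans; [apply (Cmod_orbit_term_le theta k u M N z n H HM)|].
  pose proof (Rle_trans _ _ _ (Cmod_ge_0 _) (HM 0%nat)).
  pose proof PI_RGT_0. pose proof (pos_INR N).
  unfold Rdiv. rewrite <- (Rmult_assoc M), Rmult_assoc.
  apply Rmult_le_compat_l; [apply Rmult_le_pos; nra|].
  set (q := qsub theta k n) in *. set (r := INR (cf_q theta (S (k n)))) in *.
  assert (0 < r) by (pose proof (INR_cf_q_ge_1 theta (S (k n)) H); unfold r; lra).
  eapply Rle_trans; [|apply (exp_neg_pow n q), qsub_ge; assumption].
  apply Rmult_le_reg_l with r; [assumption|].
  rewrite <- Rmult_assoc, Rinv_r, Rmult_1_l by lra.
  apply Rle_trans with (R0 ^ q); [apply pow_incr; split; [apply Cmod_ge_0 | assumption]|].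
  rewrite pow_eq_exp by assumption.
  replace (ln R0 * INR q) with ((ln R0 + 1) * INR q + - INR q) by ring.
  rewrite exp_plus. apply Rmult_le_compat_r; [left; apply exp_pos | exact Hn0].
Qed.

(** Convergence at every z justifies the chosen sum in [phi] and rewrites it through
    [orbit_term]. *)
Lemma phi_cv theta k u z : irrational theta -> super_exponential theta ->
  (forall n, (k n < k (S n))%nat) -> bounded_seq u ->
  exists s, Cseries_cv (orbit_term theta k u 1 z) s /\
    phi theta k u z = (z * Cexpi (2 * PI * theta) * s)%C.
Proof.
  intros H Hg Hk [M HM].
  destruct (orbit_term_decay theta k u M 1 z (Cmod z + 1) H Hg Hk HM) as [n0 Hn0];
    [pose proof (Cmod_ge_0 z); lra | lra |].
  unfold phi. eexists. split; [|reflexivity].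
  assert (E : forall n, orbit_term theta k u 1 z n =
    Cmul (Cmul (u (qsub theta k n))
            (Csub Cone (Cexpi (2 * PI * INR (qsub theta k n) * theta))))
         (Cpow z (qsub theta k n))).
  { intros n. unfold orbit_term. rewrite Rmult_1_l. reflexivity. }
  eapply Cseries_cv_ext; [intros n; symmetry; apply E|].
  apply (Cseries_cv_geom _ (M * (2 * PI * INR 1)) (exp (-1)) n0 exp_m1_bounds).
  intros n Hn. rewrite <- E. apply Hn0, Hn.
Qed.

(** Write 1 - l^((N+1)q) = (1 - l^(Nq)) + l^(Nq) (1 - l^q) and absorb l^(Nq) into (l^N z)^q. *)
Lemma orbit_term_S theta k u N z n :
  orbit_term theta k u (S N) z n =
  (orbit_term theta k u N z n
   + orbit_term theta k u 1 (Cexpi (INR N * (2 * PI * theta)) * z) n)%C.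
Proof.
  unfold orbit_term. set (q := qsub theta k n).
  rewrite Cpow_mult_l, Cexpi_pow, S_INR.
  replace (INR q * (INR N * (2 * PI * theta))) with (INR N * (2 * PI * INR q * theta)) by ring.
  rewrite Rmult_plus_distr_r, Rmult_1_l, Cexpi_plus. simpl INR. rewrite Rmult_1_l. ring.
Qed.

(* Telescoping: [(1 - l^q)(1 + l^q + ... + l^((N-1)q)) = 1 - l^(Nq)]. *)
Lemma iterate_Amap theta k u (w z : C) N : irrational theta -> super_exponential theta ->
  (forall n, (k n < k (S n))%nat) -> bounded_seq u ->
  exists h, Cseries_cv (orbit_term theta k u N z) h /\
    iterate (Amap theta k u) N (w, z) =
    ((Cexpi (INR N * (2 * PI * theta)) * (w + z * h))%C,
     (Cexpi (INR N * (2 * PI * theta)) * z)%C).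
Proof.
  intros H Hg Hk Hu. induction N as [|N [h [Hh E]]].
  - exists (RtoC 0). rewrite Rmult_0_l.
    replace (Cexpi 0) with (RtoC 1) by (unfold Cexpi; rewrite cos_0, sin_0; reflexivity).
    split.
    + apply (Cseries_cv_ext (fun _ => RtoC 0)); [|apply Cseries_cv_0].
      intros n. unfold orbit_term. simpl INR. rewrite Rmult_0_l.
      replace (Cexpi 0) with (RtoC 1) by (unfold Cexpi; rewrite cos_0, sin_0; reflexivity).
      ring.
    + apply (f_equal2 (@pair C C)); ring.
  - set (lz := (Cexpi (INR N * (2 * PI * theta)) * z)%C) in *.
    destruct (phi_cv theta k u lz H Hg Hk Hu) as [s [Hs Ephi]].
    exists (h + s)%C. split.
    + eapply Cseries_cv_ext; [|apply (Cseries_cv_plus _ _ _ _ Hh Hs)].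
      intros n. symmetry. apply orbit_term_S.
    + change (iterate (Amap theta k u) (S N) (w, z))
        with (Amap theta k u (iterate (Amap theta k u) N (w, z))).
      rewrite E. unfold Amap. simpl fst; simpl snd. rewrite Ephi.
      change Cadd with Cplus. change Cmul with Cmult.
      rewrite S_INR, Rmult_plus_distr_r, Rmult_1_l, Cexpi_plus.
      unfold lz. apply (f_equal2 (@pair C C)); ring.
Qed.

Lemma orbit_term_sum_bound theta k u M N z r h : irrational theta ->
  (forall n, (k n < k (S n))%nat) -> (forall m, Cmod (u m) <= M) ->
  r < 1 -> Cmod z <= r -> Cseries_cv (orbit_term theta k u N z) h ->
  Cmod h <= 2 * M / (1 - r).
Proof.
  intros H Hk HM Hr Hz Hh. pose proof (Cmod_ge_0 z).
  pose proof (Rle_trans _ _ _ (Cmod_ge_0 _) (HM 0%nat)).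
  apply (Cseries_cv_bound _ _ _ Hh). intros j.
  apply Rle_trans with (sum_f_R0 (fun n => r ^ n * (2 * M)) j).
  - apply Cmod_Csum_le. intros n.
    eapply Rle_trans; [apply (Cmod_orbit_term_le_2 theta k u M N z n H HM)|].
    rewrite Rmult_comm. apply Rmult_le_compat_r; [lra|].
    eapply Rle_trans; [apply (pow_incr _ r); lra|].
    apply pow_le_pow_of_le_1; [lra|]. apply qsub_ge; assumption.
  - rewrite <- scal_sum. unfold Rdiv. apply Rmult_le_compat_l; [lra|].
    apply sum_geom_le. lra.
Qed.

(** L does not depend on N, as equicontinuity demands. With r = s^2, one factor s^q absorbs the
    factor q and the other is at most s^n, which is summable. *)
Lemma orbit_term_sum_lipschitz theta k u M r : irrational theta ->
  (forall n, (k n < k (S n))%nat) -> (forall m, Cmod (u m) <= M) -> 0 < r < 1 ->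
  exists L, 0 <= L /\ forall N z y h g, Cmod z <= r -> Cmod y <= r ->
    Cseries_cv (orbit_term theta k u N z) h ->
    Cseries_cv (orbit_term theta k u N y) g ->
    Cmod (h - g) <= L * Cmod (z - y).
Proof.
  intros H Hk HM Hr.
  pose proof (Rle_trans _ _ _ (Cmod_ge_0 _) (HM 0%nat)) as HM0.
  set (s := sqrt r).
  assert (Hss : s * s = r) by (apply sqrt_sqrt; lra).
  assert (Hs0 : 0 < s) by (apply sqrt_lt_R0; lra).
  assert (Hs : 0 <= s < 1) by nra.
  assert (Hi : 0 < / (1 - s)) by (apply Rinv_0_lt_compat; lra).
  assert (Hri : 0 < / r) by (apply Rinv_0_lt_compat; lra).
  (* 2 bounds the chord, M the coefficient, 1/(1-s) the product q s^q, and 1/r undoes the factor r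
     in [Cmod_pow_minus_le]. *)
  set (T := 2 * M * / (1 - s) * / r).
  assert (HT : 0 <= T) by (unfold T; repeat apply Rmult_le_pos; lra).
  exists (T * / (1 - s)). split; [nra|].
  intros N z y h g Hz Hy Hh Hg.
  pose proof (Cmod_ge_0 (z - y)) as He. set (e := Cmod (z - y)) in *.
  apply (Cseries_cv_bound _ _ _ (Cseries_cv_minus _ _ _ _ Hh Hg)). intros j.
  apply Rle_trans with (sum_f_R0 (fun n => s ^ n * (T * e)) j).
  2:{ rewrite <- scal_sum. replace (T * / (1 - s) * e) with (T * e * / (1 - s)) by ring.
      apply Rmult_le_compat_l; [apply Rmult_le_pos; assumption | apply sum_geom_le, Hs]. }
  apply Cmod_Csum_le. intros n. unfold orbit_term.
  set (q := qsub theta k n).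
  assert (Hq : (n <= q)%nat) by (apply qsub_ge; assumption).
  set (c := u q). set (x := Cexpi _).
  replace (c * (1 - x) * Complex.Cpow z q - c * (1 - x) * Complex.Cpow y q)%C
    with (c * (1 - x) * (Complex.Cpow z q - Complex.Cpow y q))%C by ring.
  rewrite !Cmod_mult. unfold x at 1. rewrite Cmod_1_minus_Cexpi.
  pose proof (chord_le_2 (INR N * (2 * PI * INR q * theta))) as Hx.
  pose proof (sqrt_pos (2 - 2 * cos (INR N * (2 * PI * INR q * theta)))) as Hx0.
  set (d := sqrt (2 - 2 * cos (INR N * (2 * PI * INR q * theta)))) in *.
  pose proof (Cmod_pow_minus_le z y r q Hz Hy) as P. fold e in P.
  pose proof (Cmod_ge_0 (Complex.Cpow z q - Complex.Cpow y q)) as HD.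
  set (D := Cmod (Complex.Cpow z q - Complex.Cpow y q)) in *.
  assert (HDr : D <= / (1 - s) * / r * s ^ n * e).
  { apply Rmult_le_reg_l with r; [lra|].
    eapply Rle_trans; [exact P|].
    replace (r * (/ (1 - s) * / r * s ^ n * e)) with (/ (1 - s) * s ^ n * e) by (field; lra).
    apply Rmult_le_compat_r; [exact He|].
    rewrite <- Hss, Rpow_mult_distr, <- Rmult_assoc.
    apply Rmult_le_compat.
    - apply Rmult_le_pos; [apply pos_INR | apply pow_le; lra].
    - apply pow_le; lra.
    - apply INR_mul_pow_le, Hs.
    - apply pow_le_pow_of_le_1; [lra | exact Hq]. }
  pose proof (HM q) as Hc. fold c in Hc. pose proof (Cmod_ge_0 c).
  replace (s ^ n * (T * e)) with (M * 2 * (/ (1 - s) * / r * s ^ n * e)) by (unfold T; ring).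
  apply Rmult_le_compat; [apply Rmult_le_pos; lra | exact HD | | exact HDr].
  apply Rmult_le_compat; lra.
Qed.

(** * Unbounded orbits *)


(** Failure of convergence to 0 along q', with a fixed lower bound d so that small perturbations
    preserve it. *)
Definition nonvanishing (theta : R) (k : nat -> nat) (u : nat -> Cx) : Prop :=
  exists d, 0 < d /\ forall m0, exists m, (m0 <= m)%nat /\ d <= Cmod (u (qsub theta k m)).

(** With e the error, N is the first integer above 1/(4e). Since e <= 1/2, the product N e lies in
    [1/4, 3/4], so the angle lies between pi/2 and 3 pi/2. *)
Lemma exists_half_turn theta n : irrational theta ->
  2 <= INR (cf_q theta (S n)) ->
  exists N, INR N <= 2 * INR (cf_q theta (S n)) /\
    cos (2 * PI * INR N * cf_err theta n) <= 0.
Proof.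
  intros H Hr. pose proof (cf_err_bounds theta n H) as [Hlo Hup].
  pose proof (cf_err_pos theta n H) as He.
  set (r := INR (cf_q theta (S n))) in *. set (e := cf_err theta n) in *.
  set (x := / (4 * e)).
  assert (Hx : 0 < x) by (apply Rinv_0_lt_compat; lra).
  assert (Hxe : 4 * (x * e) = 1) by (unfold x; field; lra).
  assert (Her : / r * r = 1) by (apply Rinv_l; lra).
  assert (Her2 : / (2 * r) * r = / 2) by (field; lra).
  destruct (archimed x) as [A1 A2].
  assert (0 <= up x)%Z by (apply le_IZR; lra).
  exists (Z.to_nat (up x)). rewrite INR_IZR_INZ, Z2Nat.id by assumption.
  set (N := IZR (up x)) in *.
  assert (Hxr : x <= r / 2).
  { apply Rmult_le_reg_r with (4 * e); [lra|].
    assert (/ (2 * r) * r <= e * r) by (apply Rmult_le_compat_r; lra). lra. }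
  split; [lra|].
  assert (e <= / 2) by (apply Rmult_le_reg_r with r; [lra|]; nra).
  pose proof PI_RGT_0.
  assert (/ 4 <= N * e <= 3 / 4) by nra.
  apply cos_le_0; nra.
Qed.

Lemma sum_indicator_le m H j : 0 <= H ->
  sum_f_R0 (fun n => if lt_dec n m then H else 0) j <= INR m * H.
Proof.
  intros HH.
  (* The sum runs over j + 1 indices, of which min(j + 1, m) lie below m. *)
  assert (E : sum_f_R0 (fun n => if lt_dec n m then H else 0) j = INR (Nat.min (S j) m) * H).
  { induction j as [|j IH].
    - simpl sum_f_R0. destruct (lt_dec 0 m).
      + replace (Nat.min 1 m) with 1%nat by lia. simpl. lra.
      + replace (Nat.min 1 m) with 0%nat by lia. simpl. lra.
    - simpl sum_f_R0. rewrite IH. destruct (lt_dec (S j) m).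
      + replace (Nat.min (S (S j)) m) with (S (Nat.min (S j) m)) by lia.
        rewrite S_INR. lra.
      + replace (Nat.min (S (S j)) m) with (Nat.min (S j) m) by lia. lra. }
  rewrite E. apply Rmult_le_compat_r; [exact HH|]. apply le_INR. lia.
Qed.

(** Bernoulli's inequality for the square root of x, once squared, gives quadratic growth. *)
Lemma exponential_dominates_linear x d A B : 1 < x -> 0 < d -> 0 <= A -> 0 <= B ->
  exists n0, forall n, (n0 <= n)%nat -> A * (INR n + 1) + B < d * x ^ n.
Proof.
  intros Hx Hd HA HB.
  set (s := sqrt x).
  assert (Hss : s * s = x) by (apply sqrt_sqrt; lra).
  assert (Hs : 1 < s) by (rewrite <- sqrt_1; apply sqrt_lt_1; lra).
  set (a := s - 1). assert (Ha : 0 < a) by (unfold a; lra).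
  set (c := d * (a * a)). assert (Hc : 0 < c) by (unfold c; apply Rmult_lt_0_compat; nra).
  destruct (archimed ((2 * A + B + 1) / c)) as [A1 _].
  assert (0 < (2 * A + B + 1) / c) by (apply Rdiv_lt_0_compat; lra).
  exists (S (Z.to_nat (up ((2 * A + B + 1) / c)))). intros n Hn.
  assert (Hn1 : 1 <= INR n) by (apply (le_INR 1); lia).
  assert (Hnc : (2 * A + B + 1) / c <= INR n).
  { apply Rle_trans with (INR (Z.to_nat (up ((2 * A + B + 1) / c)))); [|apply le_INR; lia].
    rewrite INR_IZR_INZ, Z2Nat.id; [lra|]. apply le_IZR. lra. }
  assert (Hnc' : 2 * A + B + 1 <= INR n * c).
  { apply Rmult_le_compat_r with (r := c) in Hnc; [|lra].
    replace ((2 * A + B + 1) / c * c) with (2 * A + B + 1) in Hnc by (field; lra). lra. }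
  pose proof (poly n a Ha) as P. replace (1 + a) with s in P by (unfold a; ring).
  rewrite <- Hss, Rpow_mult_distr.
  assert (Hna : 0 <= INR n * a) by nra.
  assert (INR n * a * (INR n * a) <= s ^ n * s ^ n) by (apply Rmult_le_compat; lra).
  apply Rlt_le_trans with (d * (INR n * a * (INR n * a))); [|apply Rmult_le_compat_l; lra].
  replace (d * (INR n * a * (INR n * a))) with (INR n * (INR n * c)) by (unfold c; ring).
  nra.
Qed.

(** * Comparison of the Euclidean metric with the coordinates *)

Lemma C2dist_fst (p p' : C2) : Cmod (fst p - fst p') <= C2dist p p'.
Proof.
  unfold C2dist. change (Cnorm (Csub (fst p) (fst p'))) with (Cmod (fst p - fst p')).
  pose proof (Cmod_ge_0 (fst p - fst p')).
  rewrite <- (sqrt_pow2 (Cmod (fst p - fst p'))) at 1 by assumption.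
  apply sqrt_le_1_alt. nra.
Qed.

Lemma C2dist_snd (p p' : C2) : Cmod (snd p - snd p') <= C2dist p p'.
Proof.
  unfold C2dist. change (Cnorm (Csub (snd p) (snd p'))) with (Cmod (snd p - snd p')).
  pose proof (Cmod_ge_0 (snd p - snd p')).
  rewrite <- (sqrt_pow2 (Cmod (snd p - snd p'))) at 1 by assumption.
  apply sqrt_le_1_alt. nra.
Qed.

Lemma C2dist_le (p p' : C2) :
  C2dist p p' <= Cmod (fst p - fst p') + Cmod (snd p - snd p').
Proof.
  unfold C2dist. change (Cnorm (Csub (fst p) (fst p'))) with (Cmod (fst p - fst p')).
  change (Cnorm (Csub (snd p) (snd p'))) with (Cmod (snd p - snd p')).
  pose proof (Cmod_ge_0 (fst p - fst p')). pose proof (Cmod_ge_0 (snd p - snd p')).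
  rewrite <- (sqrt_pow2 (Cmod (fst p - fst p') + Cmod (snd p - snd p'))) by lra.
  apply sqrt_le_1_alt. nra.
Qed.

Lemma Cmod_le_minus (a b : C) : Cmod a <= Cmod b + Cmod (a - b).
Proof.
  replace a with (b + (a - b))%C at 1 by ring. apply Cmod_triangle.
Qed.

Lemma Cmod_minus_sym (a b : C) : Cmod (a - b) = Cmod (b - a).
Proof. rewrite <- Cmod_opp. f_equal. ring. Qed.

Lemma C2dist_sym (p p' : C2) : C2dist p p' = C2dist p' p.
Proof.
  unfold C2dist. f_equal. f_equal; f_equal; apply Cmod_minus_sym.
Qed.

Lemma C2norm_fst (p : C2) : Cmod (fst p) <= C2norm p.
Proof.
  replace (Cmod (fst p)) with (Cmod (fst p - 0)) by (f_equal; ring).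
  exact (C2dist_fst p (Czero, Czero)).
Qed.

Lemma C2norm_snd (p : C2) : Cmod (snd p) <= C2norm p.
Proof.
  replace (Cmod (snd p)) with (Cmod (snd p - 0)) by (f_equal; ring).
  exact (C2dist_snd p (Czero, Czero)).
Qed.

Lemma C2norm_le (p : C2) : C2norm p <= Cmod (fst p) + Cmod (snd p).
Proof.
  replace (fst p) with (fst p - 0)%C by ring. replace (snd p) with (snd p - 0)%C by ring.
  exact (C2dist_le p (Czero, Czero)).
Qed.

(** A coordinatewise form of the triangle inequality; the factors 2 are harmless where only
    boundedness matters. *)
Lemma C2norm_le_C2dist (p p' : C2) : C2norm p <= 2 * C2norm p' + 2 * C2dist p p'.
Proof.
  pose proof (C2norm_le p). pose proof (C2norm_fst p'). pose proof (C2norm_snd p').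
  pose proof (C2dist_fst p p'). pose proof (C2dist_snd p p').
  pose proof (Cmod_le_minus (fst p) (fst p')). pose proof (Cmod_le_minus (snd p) (snd p')).
  lra.
Qed.

(* Around half a turn of the [m]-th term, the factor [1 - l^(N q_m)] has modulus at
   least 1, and [N <= 2 q_(m+1)] keeps the terms beyond [m] summable while the terms
   before [m] are dwarfed by [z^q_m]. *)
Lemma orbit_unbounded_outside theta k u (w z : C) : irrational theta ->
  super_exponential theta -> (forall n, (k n < k (S n))%nat) ->
  bounded_seq u -> nonvanishing theta k u -> 1 < Cmod z ->
  orbit_unbounded (Amap theta k u) (w, z).
Proof.
  intros H Hg Hk Hu [d [Hd Hinf]] Hz [M' HM'].
  destruct Hu as [M HM]. assert (Hu : bounded_seq u) by (exists M; exact HM).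
  change (forall m, Cmod (u m) <= M) in HM.
  pose proof (Rle_trans _ _ _ (Cmod_ge_0 _) (HM 0%nat)) as HM0.
  set (R0 := Cmod z) in *.
  assert (HlnR : 0 < ln R0) by (rewrite <- ln_1; apply ln_increasing; lra).
  pose proof PI_RGT_0 as HPI. pose proof exp_m1_bounds as He1.
  set (A := 4 * PI * M). assert (HA : 0 <= A) by (unfold A; nra).
  set (T := A * / (1 - exp (-1))).
  assert (HT : 0 <= T).
  { apply Rmult_le_pos; [exact HA|]. left. apply Rinv_0_lt_compat. lra. }
  pose proof (Cmod_ge_0 w) as Hw.
  assert (HM'0 : 0 <= M').
  { eapply Rle_trans; [|apply (HM' 0%nat)]. apply sqrt_pos. }
  (* ln R0 pays for R0^q, one unit for N <= 2 exp(q), and the other leaves the decay exp(-q). *)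
  destruct (exp_qsub_le theta k (ln R0 + 2) H Hg Hk) as [n0 Hn0].
  destruct (exponential_dominates_linear R0 d (2 * M) (M' + Cmod w + T) Hz Hd)
    as [P0 HP0]; [lra | lra |].
  (* The successor gives m a predecessor m' that is still beyond both thresholds; its denominator P
     controls all earlier terms. *)
  destruct (Hinf (S (n0 + P0))) as [m [Hm Hdm]].
  destruct m as [|m']; [lia|].
  set (P := qsub theta k m'). set (m := S m') in *. set (Q := qsub theta k m) in *.
  assert (Hm'P : (m' <= P)%nat) by (apply qsub_ge; assumption).
  (* Hence R0^Q >= R0^P R0^P, whereas the earlier terms are only of order m R0^P. *)
  assert (HPQ : (2 * P <= Q)%nat).
  { apply INR_le. apply Rle_trans with (INR (cf_q theta (S (k m')))).
    - eapply Rle_trans; [|apply Hn0; lia]. fold P.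
      rewrite mult_INR. simpl (INR 2). pose proof (pos_INR P).
      pose proof (exp_ineq1_le ((ln R0 + 2) * INR P)).
      assert (0 <= ln R0 * INR P) by nra. lra.
    - apply le_INR, cf_q_succ_le_qsub; [assumption | assumption | unfold m; lia]. }
  assert (Hrm : 2 <= INR (cf_q theta (S (k m)))).
  { apply (le_INR 2). destruct (cf_q_ge theta (k m) H) as (_ & _ & ?).
    pose proof (subsequence_ge k Hk m). unfold m in *. lia. }
  destruct (exists_half_turn theta (k m) H Hrm) as [N [HN Hcos]].
  destruct (iterate_Amap theta k u w z N H Hg Hk Hu) as [h [Hh E]].
  (* A bounded orbit bounds w + z h, hence h itself because |z| > 1. *)
  assert (Hhb : Cmod h <= M' + Cmod w).
  { pose proof (Rle_trans _ _ _ (C2norm_fst _) (HM' N)) as B.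
    rewrite E in B. simpl fst in B. rewrite Cmod_mult, Cmod_Cexpi, Rmult_1_l in B.
    pose proof (Cmod_triangle (w + z * h) (- w)) as T1.
    replace (w + z * h + - w)%C with (z * h)%C in T1 by ring.
    rewrite Cmod_mult, Cmod_opp in T1. fold R0 in T1. pose proof (Cmod_ge_0 h). nra. }
  set (Hd0 := 2 * M * R0 ^ P).
  assert (HRP : 1 <= R0 ^ P) by (apply pow_R1_Rle; lra).
  assert (HHd0 : 0 <= Hd0) by (unfold Hd0; nra).
  (* A majorant for every term but the m-th: a constant before m, geometric decay after. *)
  set (b := fun n => (if lt_dec n m then Hd0 else 0) + exp (-1) ^ n * A).
  assert (Hb1 : forall n, 0 <= exp (-1) ^ n * A)
    by (intros n; apply Rmult_le_pos; [apply pow_le; lra | exact HA]).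
  assert (Hb : Cmod (h - orbit_term theta k u N z m) <= INR m * Hd0 + T).
  { apply (Cseries_cv_Cmod_le _ _ _ _ m Hh). intros j Hj.
    apply Rle_trans with (sum_f_R0 b j).
    - apply Cmod_Csum_minus_term_le; [exact Hj | |].
      + intros n. unfold b. specialize (Hb1 n). destruct (lt_dec n m); lra.
      + intros n Hnm. unfold b. specialize (Hb1 n).
        destruct (lt_dec n m) as [Hlt|Hge].
        * apply Rle_trans with Hd0; [|lra].
          eapply Rle_trans; [apply (Cmod_orbit_term_le_2 theta k u M N z n H HM)|].
          apply Rmult_le_compat_l; [lra|]. apply Rle_pow; [fold R0; lra|].
          apply qsub_mono; [assumption | assumption | unfold m in Hlt; lia].
        * rewrite Rplus_0_l.
          eapply Rle_trans; [apply (Cmod_orbit_term_le theta k u M N z n H HM)|].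
          fold R0. set (q := qsub theta k n). set (r := INR (cf_q theta (S (k n)))).
          assert (Hr : 0 < r)
            by (pose proof (INR_cf_q_ge_1 theta (S (k n)) H); unfold r; lra).
          (* For n > m the denominator q_(k m + 1) is at most q, so N <= 2q. *)
          assert (Hq : INR N <= 2 * exp (INR q)).
          { apply Rle_trans with (2 * INR q).
            - eapply Rle_trans; [exact HN|]. apply Rmult_le_compat_l; [lra|].
              apply le_INR, cf_q_succ_le_qsub; [assumption | assumption | lia].
            - pose proof (exp_ineq1_le (INR q)). lra. }
          assert (Hrq : R0 ^ q * (exp (INR q) * exp (INR q)) <= r).
          { eapply Rle_trans; [|apply (Hn0 n); unfold m in *; lia].
            rewrite pow_eq_exp by lra. rewrite <- !exp_plus. right. f_equal. fold q. ring. }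
          eapply Rle_trans; [|apply Rmult_le_compat_r; [exact HA|];
            apply (exp_neg_pow n q), qsub_ge; assumption].
          pose proof (exp_pos (INR q)) as Hex.
          assert (Hxx : exp (- INR q) = / exp (INR q)) by apply exp_Ropp.
          rewrite Hxx.
          assert (HRq : 0 < R0 ^ q) by (apply pow_lt; lra).
          apply Rmult_le_reg_r with (r * exp (INR q)); [nra|].
          replace (M * (2 * PI * INR N / r) * R0 ^ q * (r * exp (INR q)))
            with (2 * PI * M * (R0 ^ q * exp (INR q)) * INR N) by (field; lra).
          replace (/ exp (INR q) * A * (r * exp (INR q))) with (A * r) by (field; lra).
          apply Rle_trans with (2 * PI * M * (R0 ^ q * exp (INR q)) * (2 * exp (INR q))).
          -- apply Rmult_le_compat_l; [|exact Hq].
             apply Rmult_le_pos; [nra|]. apply Rmult_le_pos; lra.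
          -- replace (2 * PI * M * (R0 ^ q * exp (INR q)) * (2 * exp (INR q)))
               with (A * (R0 ^ q * (exp (INR q) * exp (INR q)))) by (unfold A; ring).
             apply Rmult_le_compat_l; [exact HA | exact Hrq].
    - unfold b. rewrite plus_sum. apply Rplus_le_compat.
      + apply sum_indicator_le, HHd0.
      + rewrite <- scal_sum. apply Rmult_le_compat_l; [exact HA|].
        apply sum_geom_le, He1. }
  (* The nonpositive cosine makes the chord at least 1. *)
  assert (Hterm : d * R0 ^ Q <= Cmod (orbit_term theta k u N z m)).
  { rewrite Cmod_orbit_term by exact H. fold Q R0.
    apply Rmult_le_compat_r; [apply pow_le; lra|].
    apply Rle_trans with (Cmod (u Q) * 1); [lra|].
    apply Rmult_le_compat_l; [apply Cmod_ge_0|].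
    rewrite <- sqrt_1. apply sqrt_le_1_alt. lra. }
  assert (Hup : d * R0 ^ Q <= M' + Cmod w + INR m * Hd0 + T).
  { pose proof (Cmod_le_minus (orbit_term theta k u N z m) h) as T1.
    rewrite Cmod_minus_sym in T1. lra. }
  specialize (HP0 P ltac:(lia)).
  assert (R0 ^ P * R0 ^ P <= R0 ^ Q).
  { rewrite <- pow_add. apply Rle_pow; [lra | lia]. }
  assert (INR m <= INR P + 1).
  { rewrite <- S_INR. apply le_INR. unfold m. lia. }
  assert (d * (R0 ^ P * R0 ^ P) <= d * R0 ^ Q) by (apply Rmult_le_compat_l; lra).
  assert (INR m * Hd0 <= (INR P + 1) * Hd0) by (apply Rmult_le_compat_r; lra).
  (* The choice of P0, multiplied by R0^P >= 1, contradicts the upper bound [Hup]. *)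
  assert (X : (2 * M * (INR P + 1) + (M' + Cmod w + T)) * R0 ^ P < d * R0 ^ P * R0 ^ P)
    by (apply Rmult_lt_compat_r; lra).
  unfold Hd0 in *. nra.
Qed.

(** * The Fatou component *)


Lemma orbit_bounded_inside theta k u (w z : C) : irrational theta ->
  super_exponential theta -> (forall n, (k n < k (S n))%nat) -> bounded_seq u ->
  Cmod z < 1 ->
  exists B, forall N, C2norm (iterate (Amap theta k u) N (w, z)) <= B.
Proof.
  intros H Hg Hk [M HM] Hz. assert (Hu : bounded_seq u) by (exists M; exact HM).
  change (forall m, Cmod (u m) <= M) in HM.
  exists (Cmod w + 2 * M / (1 - Cmod z) + 1). intros N.
  destruct (iterate_Amap theta k u w z N H Hg Hk Hu) as [h [Hh ->]].
  pose proof (orbit_term_sum_bound theta k u M N z (Cmod z) h H Hk HM Hz (Rle_refl _) Hh).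
  eapply Rle_trans; [apply C2norm_le|]. simpl fst; simpl snd.
  rewrite !Cmod_mult, !Cmod_Cexpi, !Rmult_1_l.
  pose proof (Cmod_triangle w (z * h)) as T. rewrite Cmod_mult in T.
  pose proof (Cmod_ge_0 z). pose proof (Cmod_ge_0 h). nra.
Qed.

(** Up to a rotation, first coordinates differ by (w - v) + (z - y) h + y (h - g), where h is
    bounded and h - g is Lipschitz, uniformly in N. *)
Lemma fatou_set_inside theta k u (p : C2) : irrational theta ->
  super_exponential theta -> (forall n, (k n < k (S n))%nat) -> bounded_seq u ->
  C_times_disc p -> fatou_set (Amap theta k u) p.
Proof.
  intros H Hg Hk [M HM] Hp. assert (Hu : bounded_seq u) by (exists M; exact HM).
  change (forall m, Cmod (u m) <= M) in HM. change (Cmod (snd p) < 1) in Hp.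
  pose proof (Rle_trans _ _ _ (Cmod_ge_0 _) (HM 0%nat)) as HM0.
  pose proof (Cmod_ge_0 (snd p)) as Hp0.
  (* The midpoint between |z| and 1: the ball of radius 1 - r around p stays in |z| <= r. *)
  set (r := (1 + Cmod (snd p)) / 2). assert (Hr : 0 < r < 1) by (unfold r; lra).
  destruct (orbit_term_sum_lipschitz theta k u M r H Hk HM Hr) as [L [HL0 HL]].
  set (B := 2 * M / (1 - r)).
  assert (HB0 : 0 <= B).
  { unfold B, Rdiv. apply Rmult_le_pos; [lra|]. left. apply Rinv_0_lt_compat. lra. }
  exists (1 - r). split; [lra|].
  assert (Hball : forall y : C2, C2dist p y < 1 - r -> Cmod (snd y) <= r).
  { intros y Hy. pose proof (C2dist_snd p y). pose proof (Cmod_le_minus (snd y) (snd p)) as T.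
    rewrite Cmod_minus_sym in T. unfold r in *. lra. }
  intros [w z] Hx eps Heps. pose proof (Hball _ Hx) as Hz. simpl snd in Hz.
  assert (HK : 0 < 2 + B + L) by lra.
  (* One unit for each of w - v and the second coordinate, B for (z - y) h and L for y (h - g). *)
  exists (eps / (2 + B + L)). split; [apply Rdiv_lt_0_compat; lra|].
  intros [v y] Hvy Hd N. pose proof (Hball _ Hvy) as Hy. simpl snd in Hy.
  change (@pair Cx Cx w z) with (@pair C C w z) in *.
  change (@pair Cx Cx v y) with (@pair C C v y) in *.
  destruct (iterate_Amap theta k u w z N H Hg Hk Hu) as [h [Hh ->]].
  destruct (iterate_Amap theta k u v y N H Hg Hk Hu) as [g [Hg' ->]].
  pose proof (orbit_term_sum_bound theta k u M N z r h H Hk HM (proj2 Hr) Hz Hh) as Hhb.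
  fold B in Hhb. specialize (HL N z y h g Hz Hy Hh Hg').
  pose proof (C2dist_fst (w, z) (v, y)) as D1. pose proof (C2dist_snd (w, z) (v, y)) as D2.
  set (D := C2dist (w, z) (v, y)) in *. simpl in D1, D2.
  eapply Rle_lt_trans; [apply C2dist_le|]. simpl fst; simpl snd.
  set (l := Cexpi (INR N * (2 * PI * theta))).
  replace (l * (w + z * h) - l * (v + y * g))%C
    with (l * ((w - v) + ((z - y) * h + y * (h - g))))%C by ring.
  replace (l * z - l * y)%C with (l * (z - y))%C by ring.
  rewrite !Cmod_mult. unfold l. rewrite !Cmod_Cexpi, !Rmult_1_l.
  pose proof (Cmod_triangle (w - v) ((z - y) * h + y * (h - g))) as T1.
  pose proof (Cmod_triangle ((z - y) * h) (y * (h - g))) as T2.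
  rewrite !Cmod_mult in T2.
  pose proof (Cmod_ge_0 (z - y)). pose proof (Cmod_ge_0 y). pose proof (Cmod_ge_0 h).
  pose proof (Cmod_ge_0 (h - g)).
  assert (Cmod (z - y) * Cmod h <= D * B) by (apply Rmult_le_compat; lra).
  assert (Cmod y * Cmod (h - g) <= 1 * (L * D)).
  { apply Rmult_le_compat; try lra. eapply Rle_trans; [exact HL|].
    apply Rmult_le_compat_l; lra. }
  apply Rle_lt_trans with (D * (2 + B + L)); [lra|].
  apply Rmult_lt_compat_r with (r := 2 + B + L) in Hd; [|exact HK].
  replace (eps / (2 + B + L) * (2 + B + L)) with eps in Hd by (field; lra). exact Hd.
Qed.

(* Equicontinuity at a point of [|z| = 1] would propagate boundedness from nearby orbits
   inside to nearby orbits outside. *)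
Lemma fatou_set_not_on_boundary (F : C2 -> C2) (p : C2) :
  (forall w z : C, Cmod z < 1 -> exists B, forall N, C2norm (iterate F N (w, z)) <= B) ->
  (forall w z : C, 1 < Cmod z -> orbit_unbounded F (w, z)) ->
  fatou_set F p -> Cmod (snd p) <> 1.
Proof.
  intros Hin Hout [r [Hr HF]] Hp. destruct p as [w z]. simpl in Hp.
  assert (Hpp : C2dist (w, z) (w, z) < r).
  { eapply Rle_lt_trans; [apply C2dist_le|]. simpl fst; simpl snd.
    replace (w - w)%C with (RtoC 0) by ring. replace (z - z)%C with (RtoC 0) by ring.
    rewrite Cmod_0. lra. }
  destruct (HF _ Hpp 1 Rlt_0_1) as [d [Hd Heq]].
  (* Both points (w, (1 + t) z) and (w, (1 - t) z) are within r and d of p, on opposite sides of the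
     circle. *)
  set (t := Rmin 1 (Rmin r d) / 2).
  assert (Ht : 0 < t < 1 /\ t < r /\ t < d).
  { unfold t. pose proof (Rmin_l 1 (Rmin r d)). pose proof (Rmin_r 1 (Rmin r d)).
    pose proof (Rmin_l r d). pose proof (Rmin_r r d).
    assert (0 < Rmin 1 (Rmin r d)) by (repeat apply Rmin_glb_lt; lra). lra. }
  set (x := (w, z) : C2) in *.
  set (y := fun s => (w, (RtoC (1 + s) * z)%C) : C2).
  assert (Hdist : forall s, Rabs s = t -> C2dist x (y s) <= t).
  { intros s Hs. eapply Rle_trans; [apply C2dist_le|]. simpl fst; simpl snd.
    replace (w - w)%C with (RtoC 0) by ring.
    replace (z - RtoC (1 + s) * z)%C with (RtoC (- s) * z)%C
      by (rewrite RtoC_plus, RtoC_opp; ring).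
    rewrite Cmod_0, Cmod_mult, Cmod_R, Hp, Rabs_Ropp. lra. }
  assert (Hs1 : Rabs t = t) by (apply Rabs_right; lra).
  assert (Hs2 : Rabs (- t) = t) by (rewrite Rabs_Ropp; exact Hs1).
  pose proof (Hdist t Hs1) as D1. pose proof (Hdist (- t) Hs2) as D2.
  destruct (Hin w (RtoC (1 + - t) * z)%C) as [B HB].
  { rewrite Cmod_mult, Cmod_R, Hp, Rabs_right; lra. }
  apply (Hout w (RtoC (1 + t) * z)%C).
  { rewrite Cmod_mult, Cmod_R, Hp, Rabs_right; lra. }
  (* [C2norm_le_C2dist] is used twice, from the inner orbit to that of p and on to the outer one,
     each at distance below 1. *)
  exists (2 * (2 * B + 2) + 2). intros N.
  change (C2norm (iterate F N (y t)) <= 2 * (2 * B + 2) + 2).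
  pose proof (HB N : C2norm (iterate F N (y (- t))) <= B) as B1.
  pose proof (Heq (y t) ltac:(lra) ltac:(lra) N) as E1.
  pose proof (Heq (y (- t)) ltac:(lra) ltac:(lra) N) as E2.
  pose proof (C2norm_le_C2dist (iterate F N x) (iterate F N (y (- t)))) as N1.
  pose proof (C2norm_le_C2dist (iterate F N (y t)) (iterate F N x)) as N2.
  rewrite (C2dist_sym (iterate F N (y t))) in N2. lra.
Qed.

(** * Segments and connectedness of convex sets *)

Definition C2segment (x y : C2) (t : R) : C2 :=
  ((fst x + RtoC t * (fst y - fst x))%C, (snd x + RtoC t * (snd y - snd x))%C).

Lemma C2dist_segment x y s t :
  C2dist (C2segment x y s) (C2segment x y t) <=
  Rabs (t - s) * (Cmod (fst y - fst x) + Cmod (snd y - snd x)).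
Proof.
  eapply Rle_trans; [apply C2dist_le|]. unfold C2segment. simpl fst; simpl snd.
  assert (E : forall a b : C, Cmod (a + RtoC s * (b - a) - (a + RtoC t * (b - a))) =
                              Rabs (t - s) * Cmod (b - a)).
  { intros a b.
    replace (a + RtoC s * (b - a) - (a + RtoC t * (b - a)))%C
      with (RtoC (- (t - s)) * (b - a))%C
      by (rewrite RtoC_opp, RtoC_minus; ring).
    rewrite Cmod_mult, Cmod_R, Rabs_Ropp. reflexivity. }
  rewrite !E. lra.
Qed.

Lemma open_segment U x y t : C2open U -> U (C2segment x y t) ->
  exists d, 0 < d /\ forall s, Rabs (s - t) < d -> U (C2segment x y s).
Proof.
  intros HU Ht. destruct (HU _ Ht) as [r [Hr HUr]].
  set (l := Cmod (fst y - fst x) + Cmod (snd y - snd x)).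
  assert (Hl : 0 <= l).
  { unfold l. pose proof (Cmod_ge_0 (fst y - fst x)). pose proof (Cmod_ge_0 (snd y - snd x)). lra. }
  exists (r / (l + 1)). split; [apply Rdiv_lt_0_compat; lra|].
  intros s Hs. apply HUr. eapply Rle_lt_trans; [apply C2dist_segment|]. fold l.
  pose proof (Rabs_pos (s - t)).
  apply Rmult_lt_compat_r with (r := l + 1) in Hs; [|lra].
  replace (r / (l + 1) * (l + 1)) with r in Hs by (field; lra). nra.
Qed.

Lemma C2segment_0 x y : C2segment x y 0 = x.
Proof. unfold C2segment. destruct x. simpl. apply (f_equal2 (@pair C C)); ring. Qed.

Lemma C2segment_1 x y : C2segment x y 1 = y.
Proof. unfold C2segment. destruct y. simpl. apply (f_equal2 (@pair C C)); ring. Qed.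

(** A separation would split a segment from x in U2 to y in U1; the supremum of the parameters lying
    in U2 can belong to neither open set. *)
Lemma C2connected_convex (T : C2 -> Prop) :
  (forall x y t, T x -> T y -> 0 <= t <= 1 -> T (C2segment x y t)) -> C2connected T.
Proof.
  intros HT U1 U2 HU1 HU2 Hcov Hdis.
  apply NNPP. intros HN. apply not_or_and in HN as [N1 N2].
  apply not_all_ex_not in N1 as [x Hx]. apply not_all_ex_not in N2 as [y Hy].
  apply imply_to_and in Hx as [Tx Hx]. apply imply_to_and in Hy as [Ty Hy].
  set (E := fun t => 0 <= t <= 1 /\ U2 (C2segment x y t)).
  assert (E0 : E 0).
  { split; [lra|]. rewrite C2segment_0. destruct (Hcov x Tx); [contradiction | assumption]. }
  destruct (completeness E) as [t [Hub Hleast]].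
  { exists 1. intros s [Hs _]. lra. }
  { exists 0. exact E0. }
  assert (Ht : 0 <= t <= 1).
  { split; [apply Hub, E0|]. apply Hleast. intros s [Hs _]. lra. }
  destruct (Hcov _ (HT x y t Tx Ty Ht)) as [H1|H2].
  (* A neighbourhood of t avoids U2, so t - d is a smaller upper bound. *)
  - destruct (open_segment U1 x y t HU1 H1) as [d [Hd HUd]].
    assert (t <= t - d); [|lra].
    apply Hleast. intros s [Hs H2]. apply Rnot_lt_le. intros Hlt.
    pose proof (Hub s (conj Hs H2)).
    apply (Hdis _ (HT x y s Tx Ty Hs)); [|exact H2].
    apply HUd. rewrite Rabs_left1; lra.
  - destruct (Req_dec t 1) as [->|Ht1].
    { rewrite C2segment_1 in H2. contradiction. }
    destruct (open_segment U2 x y t HU2 H2) as [d [Hd HUd]].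
    (* A parameter beyond t, still in [0, 1] and in U2. *)
    set (s := t + Rmin (d / 2) (1 - t)).
    pose proof (Rmin_l (d / 2) (1 - t)). pose proof (Rmin_r (d / 2) (1 - t)).
    assert (0 < Rmin (d / 2) (1 - t)) by (apply Rmin_glb_lt; lra).
    assert (s <= t); [|unfold s in *; lra].
    apply Hub. split; [unfold s; lra|]. apply HUd. rewrite Rabs_right; unfold s; lra.
Qed.

Lemma C_times_disc_connected : C2connected C_times_disc.
Proof.
  apply C2connected_convex. intros x y t Hx Hy Ht.
  change (Cmod (snd x) < 1) in Hx. change (Cmod (snd y) < 1) in Hy.
  change (Cmod (snd x + RtoC t * (snd y - snd x)) < 1).
  replace (snd x + RtoC t * (snd y - snd x))%C
    with (RtoC (1 - t) * snd x + RtoC t * snd y)%C by (rewrite RtoC_minus; ring).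
  eapply Rle_lt_trans; [apply Cmod_triangle|].
  rewrite !Cmod_mult, !Cmod_R, !Rabs_right by lra.
  destruct (Req_dec t 0) as [->|]; nra.
Qed.

Lemma C_times_disc_open : C2open C_times_disc.
Proof.
  intros x Hx. change (Cmod (snd x) < 1) in Hx. exists (1 - Cmod (snd x)).
  split; [lra|]. intros y Hy. change (Cmod (snd y) < 1).
  pose proof (C2dist_snd x y). pose proof (Cmod_le_minus (snd y) (snd x)) as T.
  rewrite Cmod_minus_sym in T. lra.
Qed.

Lemma outside_open : C2open (fun p => 1 < Cmod (snd p)).
Proof.
  intros x Hx. exists (Cmod (snd x) - 1). split; [lra|]. intros y Hy.
  pose proof (C2dist_snd x y). pose proof (Cmod_le_minus (snd x) (snd y)). lra.
Qed.

(** For maximality, a connected part of the Fatou set misses |z| = 1, so the open sets |z| < 1 and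
    |z| > 1 cover it; meeting the first, it lies inside. *)
Lemma two_conclusions_nonvanishing theta k u : irrational theta ->
  super_exponential theta -> (forall n, (k n < k (S n))%nat) ->
  bounded_seq u -> nonvanishing theta k u -> two_conclusions (Amap theta k u).
Proof.
  intros H Hg Hk Hu Hnv.
  assert (Hout : forall w z : C, 1 < Cmod z -> orbit_unbounded (Amap theta k u) (w, z))
    by (intros; apply orbit_unbounded_outside; assumption).
  split; [|exact Hout].
  split; [|split; [|split]].
  - exists (Czero, Czero). change (Cmod (RtoC 0) < 1). rewrite Cmod_0. lra.
  - intros x Hx. apply fatou_set_inside; assumption.
  - exact C_times_disc_connected.
  - intros T HT HTF [x0 [Tx0 Hx0]].
    assert (Hbd : forall x, T x -> Cmod (snd x) <> 1).
    { intros x Tx. apply (fatou_set_not_on_boundary (Amap theta k u)); [|exact Hout|apply HTF, Tx].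
      intros w z Hz. apply orbit_bounded_inside; assumption. }
    destruct (HT _ _ C_times_disc_open outside_open) as [C1|C2].
    + intros x Tx. change (Cmod (snd x) < 1 \/ 1 < Cmod (snd x)).
      specialize (Hbd x Tx). lra.
    + intros x Tx Hx. change (Cmod (snd x) < 1) in Hx. lra.
    + exact C1.
    + specialize (C2 x0 Tx0). change (Cmod (snd x0) < 1) in Hx0. lra.
Qed.

(** * The generic set *)

(** A perturbation below d/2 leaves modulus at least d/2 at the same indices. *)
Lemma nonvanishing_open theta k :
  linf_open (fun u => bounded_seq u /\ nonvanishing theta k u).
Proof.
  intros u Hu [_ [d [Hd Hinf]]]. exists (d / 2). split; [lra|].
  intros v Hv [r' [Hr' Huv]]. split; [exact Hv|].
  exists (d / 2). split; [lra|]. intros m0. destruct (Hinf m0) as [m [Hm Hdm]].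
  exists m. split; [exact Hm|].
  pose proof (Cmod_le_minus (u (qsub theta k m)) (v (qsub theta k m))) as T.
  specialize (Huv (qsub theta k m)). change Cnorm with Cmod in Huv. change Csub with Cminus in Huv.
  lra.
Qed.

(* If [u] tends to 0 along [q'], any nonzero constant translate of it is nonvanishing. *)
Lemma nonvanishing_dense theta k :
  linf_dense (fun u => bounded_seq u /\ nonvanishing theta k u).
Proof.
  intros u Hu r Hr. destruct (classic (nonvanishing theta k u)) as [Hnv|Hnv].
  - exists u. split; [split; assumption|]. exists 0. split; [exact Hr|].
    intros m. change (Cmod (u m - u m) <= 0).
    replace (u m - u m)%C with (RtoC 0) by ring. rewrite Cmod_0. lra.
  (* Eventually |u| < r/4 along q', so the shift by r/2 leaves modulus at least r/4 there. *)
  - exists (fun m => (u m + RtoC (r / 2))%C).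
    assert (Hc : Cmod (RtoC (r / 2)) = r / 2) by (rewrite Cmod_R, Rabs_right; lra).
    split; [split|].
    + destruct Hu as [M HM]. exists (M + r / 2). intros m.
      specialize (HM m). change Cnorm with Cmod in *.
      pose proof (Cmod_triangle (u m) (RtoC (r / 2))). lra.
    + exists (r / 4). split; [lra|].
      assert (Hev : exists m0, forall m, (m0 <= m)%nat -> Cmod (u (qsub theta k m)) < r / 4).
      { apply NNPP. intros HN. apply Hnv. exists (r / 4). split; [lra|]. intros m0.
        apply NNPP. intros HN'. apply HN. exists m0. intros m Hm.
        apply Rnot_le_lt. intros Hle. apply HN'. exists m. split; assumption. }
      destruct Hev as [m1 Hm1]. intros m0. exists (Nat.max m0 m1). split; [lia|].
      specialize (Hm1 (Nat.max m0 m1) ltac:(lia)).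
      set (x := u (qsub theta k (Nat.max m0 m1))) in *.
      pose proof (Cmod_triangle (x + RtoC (r / 2)) (- x)) as T.
      replace (x + RtoC (r / 2) + - x)%C with (RtoC (r / 2)) in T by ring.
      rewrite Cmod_opp in T. lra.
    + exists (r / 2). split; [lra|]. intros m.
      change (Cmod (u m - (u m + RtoC (r / 2))) <= r / 2).
      replace (u m - (u m + RtoC (r / 2)))%C with (- RtoC (r / 2))%C by ring.
      rewrite Cmod_opp. lra.
Qed.

Theorem theorem2p4 (theta : R) (Hirr : irrational theta)
  (Hgrowth : cv_infty (fun n => ln (INR (cf_q theta (S n))) / INR (cf_q theta n)))
  (k : nat -> nat) (Hk : forall n, (k n < k (S n))%nat) :
  exists E1 : (nat -> Cx) -> Prop,
    linf_dense_Gdelta E1 /\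
    (forall u, E1 u -> two_conclusions (Amap theta k u)) /\
    two_conclusions (Amap theta k (fun _ => Cone)).
Proof.
  exists (fun u => bounded_seq u /\ nonvanishing theta k u). split; [|split].
  - split; [|split].
    + tauto.
    (* The set is itself open, so a constant family of open sets exhibits it as a countable
       intersection. *)
    + exists (fun _ u => bounded_seq u /\ nonvanishing theta k u). split.
      * intros _. apply nonvanishing_open.
      * intros u _. split; [auto | intros Hall; exact (Hall 0%nat)].
    + apply nonvanishing_dense.
  - intros u [Hu Hnv]. apply two_conclusions_nonvanishing; assumption.
  - apply two_conclusions_nonvanishing; try assumption.
    + exists 1. intros _. change (Cmod 1 <= 1). rewrite Cmod_1. lra.
    + exists 1. split; [lra|]. intros m0. exists m0. split; [lia|].
      change (1 <= Cmod 1). rewrite Cmod_1. lra.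
Qed.
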